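(* Fix an integer $s\ge2$. Consider $(1,s)$-square tilings of an $n\times n$ region and the weighted Markov chain $\mathrm{MC}_{(1,s)\text{-}square}$ with parameter $\lambda>0$. If $\lambda\le\frac{1}{(2s-1)^2-2}$, the chain is rapidly mixing, and there exists a positive constant $c$ such that $\tau_{mix}(\varepsilon)\le c\,n^4\log(n\varepsilon^{-1})$.
   Context: A $(1,s)$-tiling is a tiling by axis-parallel $1\times1$ and $s\times s$ squares with integer corners. A central flip replaces an $s\times s$ square by $s^2$ unit squares or vice versa. The chain $\mathrm{MC}_{(1,s)\text{-}square}$ with weight $\lambda>0$ uses only central flips: at each step choose a site of the region uniformly at random; if a central flip can be made there, put $s^2$ unit squares in the corresponding $s\times s$ block with probability $\frac1{\lambda+1}$ or an $s\times s$ square with probability $\frac{\lambda}{\lambda+1}$; otherwise do nothing. Mixing time: with stationary distribution $\pi$, $d_x(t)=\frac12\sum_y|P^t(x,y)-\pi(y)|$ and $\tau_{mix}(\varepsilon)=\max_x\min\{t:d_x(t')\le\varepsilon\ \forall t'\ge t\}$. *)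

(* Defs.v *)
From HB Require Import structures.
From mathcomp Require Import all_boot all_order all_algebra.
From mathcomp Require Import polyXY.
From mathcomp Require Import all_classical all_reals all_analysis.

Set Implicit Arguments.
Unset Strict Implicit.
Unset Printing Implicit Defensive.

Import Order.TTheory GRing.Theory Num.Theory.
Local Open Scope ring_scope.

Definition cell (n : nat) : finType := ('I_n * 'I_n)%type.

(* A placed square is its lower-left cell together with a flag: [false] for a
   unit square, [true] for an s x s square. *)
Definition square (n : nat) : finType := (cell n * bool)%type.

Definition side (s n : nat) (q : square n) : nat := if q.2 then s else 1%N.

Definition fits (s n : nat) (q : square n) : bool :=
  ((q.1.1 + side s q <= n) && (q.1.2 + side s q <= n))%N.

Definition cells (s n : nat) (q : square n) : {set cell n} :=
  [set c : cell n | (q.1.1 <= c.1 < q.1.1 + side s q)%N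
                  & (q.1.2 <= c.2 < q.1.2 + side s q)%N].

Definition is_tiling (s n : nat) (T : {set square n}) : bool :=
  [forall q in T, fits s q] &&
  [forall c : cell n, #|[set q in T | c \in cells s q]| == 1%N].

Definition tiling (s n : nat) : finType :=
  {T : {set square n} | is_tiling s T}.

(* Sites are the n^2 cells; the block of a site is the s x s block whose
   lower-left cell is that site. *)
Definition block_units (s n : nat) (v : cell n) : {set square n} :=
  [set q : square n | ~~ q.2 & q.1 \in cells s (v, true)].

Definition can_flip (s n : nat) (T : {set square n}) (v : cell n) : bool :=
  fits s (v, true) && (((v, true) \in T) || (block_units s v \subset T)).

Definition put_units (s n : nat) (T : {set square n}) (v : cell n) :
    {set square n} :=
  (T :\ (v, true)) :|: block_units s v.

Definition put_big (s n : nat) (T : {set square n}) (v : cell n) :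
    {set square n} :=
  (v, true) |: (T :\: block_units s v).

Definition MC_square (R : realType) (s : nat) (lam : R) (n : nat)
    (T T' : tiling s n) : R :=
  \sum_(v : cell n) #|cell n|%:R^-1 *
    (if can_flip s (val T) v then
       (lam + 1)^-1 * (val T' == put_units s (val T) v)%:R +
       lam / (lam + 1) * (val T' == put_big s (val T) v)%:R
     else (T' == T)%:R).

Fixpoint iter_trans (R : realType) (S : finType) (P : S -> S -> R) (t : nat)
    (x y : S) : R :=
  if t is t'.+1 then \sum_(z : S) P x z * iter_trans P t' z y
  else (x == y)%:R.

Definition stationary (R : realType) (S : finType) (P : S -> S -> R)
    (pi : S -> R) : Prop :=
  [/\ forall x, 0 <= pi x, \sum_(x : S) pi x = 1
    & forall y, \sum_(x : S) pi x * P x y = pi y].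

Definition tv_dist (R : realType) (S : finType) (P : S -> S -> R)
    (pi : S -> R) (x : S) (t : nat) : R :=
  2^-1 * \sum_(y : S) `|iter_trans P t x y - pi y|.

(* The minimum over t is taken as an infimum in the extended reals, so that the
   mixing time is +oo (and not a junk value) when no such t exists. *)
Definition tau_mix (R : realType) (S : finType) (P : S -> S -> R)
    (pi : S -> R) (eps : R) : \bar R :=
  \big[maxe/-oo%E]_(x : S)
    ereal_inf [set (t%:R)%:E | t in
      [set t : nat | forall t' : nat, (t <= t')%N ->
                       tv_dist P pi x t' <= eps]].

Definition rapidly_mixing (R : realType) (S : nat -> finType)
    (P : forall n, S n -> S n -> R) : Prop :=
  exists p : {poly {poly R}},
    forall (n : nat) (eps : R) (pi : S n -> R),
      (1 <= n)%N -> 0 < eps < 1 -> stationary (P n) pi ->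
      (tau_mix (P n) pi eps <= (p.[n%:R, ln eps^-1])%:E)%E.

(* Main.v *)
(** Encode a tiling by the set I of lower-left cells of its s x s squares: the
    chain becomes heat-bath Glauber dynamics on sets of pairwise compatible
    cells, where a cell conflicts with at most 4s(s-1) others and a conflicting
    cell is added with probability lam / (lam + 1) <= 1 / (4s(s-1)).
    Plain path coupling would only be non-expanding at the critical lam, so a
    difference at a cell v = (i, j) is weighted by w(v) = 2n^2 - i^2. The second
    difference of i^2 makes the weights of the cells conflicting with v sum to at
    most 4s(s-1)(w(v) - 1/2), and since n^2 <= w <= 2n^2 this gives a contraction
    factor 1 - 1/(4n^4). The coupling is phrased dually: a function G with
    |G(I + v) - G(I)| <= L w(v) is mapped by the chain to one with the constant
    L(1 - 1/(4n^4)). *)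

Require Import Defs.
From HB Require Import structures.
From mathcomp Require Import all_boot all_order all_algebra.
From mathcomp Require Import polyXY zify ring lra.
From mathcomp Require Import all_classical all_reals all_analysis.

Import Order.TTheory GRing.Theory Num.Theory.
Local Open Scope ring_scope.

(** * Total variation distance and mixing time of a finite chain *)

Section Mixing.
Context {R : realType} {S : finType}.
Implicit Types (P : S -> S -> R) (pi f : S -> R).

Lemma stationary_iter P pi t y : stationary P pi ->
  \sum_x pi x * iter_trans P t x y = pi y.
Proof.
case=> _ _ piP; elim: t => [|t IH] /=.
  rewrite (bigD1 y) //= eqxx mulr1 big1 ?addr0 // => x /negbTE ->.
  by rewrite mulr0.
rewrite -[RHS]IH; under eq_bigr do rewrite mulr_sumr.
rewrite exchange_big /=; apply: eq_bigr => z _.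
by rewrite -[in RHS]piP mulr_suml; apply: eq_bigr => x _; rewrite mulrA.
Qed.

(** The sign of [P^t(x,.) - pi] is a test function with values in [-1,1] that attains the l1 norm.
    By stationarity its [pi]-mean is the [pi]-average over [z] of its means under [P^t(z,.)], so the
    oscillation of [P^t f] controls the distance. *)
Lemma tv_dist_le P pi x t (B : R) : stationary P pi ->
  (forall f, (forall y, `|f y| <= 1) -> forall z,
     `|\sum_y iter_trans P t x y * f y - \sum_y iter_trans P t z y * f y| <= 2 * B) ->
  tv_dist P pi x t <= B.
Proof.
move=> st H; have [pi0 pi1 _] := st; rewrite /tv_dist.
pose f y := Num.sg (iter_trans P t x y - pi y).
have f1 y : `|f y| <= 1 by rewrite normr_sg; case: (_ != 0).
suff : \sum_y `|iter_trans P t x y - pi y| <= 2 * B by lra.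
have -> : \sum_y `|iter_trans P t x y - pi y| =
   \sum_z pi z * (\sum_y iter_trans P t x y * f y - \sum_y iter_trans P t z y * f y).
  under [RHS]eq_bigr do rewrite mulrBr.
  rewrite sumrB -mulr_suml pi1 mul1r.
  under [X in _ = _ - X]eq_bigr do rewrite mulr_sumr.
  rewrite [X in _ = _ - X]exchange_big -sumrB /=; apply: eq_bigr => y _.
  rewrite normrEsg -/(f y) mulrC mulrBl; congr (_ - _).
  by rewrite -[in LHS](stationary_iter _ _ t y st) mulr_suml; apply: eq_bigr => z _; rewrite mulrA.
apply: (@le_trans _ _ (\sum_z pi z * (2 * B))).
  by apply: ler_sum => z _; apply: ler_wpM2l => //; apply: le_trans (H f f1 z); exact: ler_norm.
by rewrite -mulr_suml pi1 mul1r.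
Qed.

Lemma tau_mix_le P pi (eps : R) t :
  (forall x t', (t <= t')%N -> tv_dist P pi x t' <= eps) ->
  (tau_mix P pi eps <= (t%:R)%:E)%E.
Proof.
move=> H; rewrite /tau_mix; apply: bigmax_le => [|x _]; first exact: leNye.
by apply: ereal_inf_lbound; exists t => // t' tt'; exact: H.
Qed.
End Mixing.

(** * Tilings as packings of large squares *)

Section Packings.
Context {R : realType} {s n : nat}.
Implicit Types (lam : R) (I J : {set cell n}) (T : {set square n}) (u v c : cell n).
Implicit Types (G : {set cell n} -> R) (f : tiling s n -> R).

Definition packing I : bool :=
  [forall u in I, fits s (u, true)] &&
  [forall c, #|[set u in I | c \in cells s (u, true)]| <= 1]%N.

Definition bigs T : {set cell n} := [set u | (u, true) \in T].

Definition tiling_set I : {set square n} :=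
  [set q | if q.2 then q.1 \in I
           else [forall u in I, q.1 \notin cells s (u, true)]].

Lemma packingP I :
  reflect ((forall u, u \in I -> fits s (u, true)) /\
           (forall u v c, u \in I -> v \in I ->
              c \in cells s (u, true) -> c \in cells s (v, true) -> u = v))
          (packing I).
Proof.
apply: (iffP andP) => -[F D]; split.
- by move=> u uI; exact: (forall_inP F).
- move=> u v c uI vI cu cv; move/forallP/(_ c)/card_le1_eqP: D.
  by move=> H; apply: H; rewrite finset.in_set ?uI ?vI.
- by apply/forall_inP.
- apply/forallP => c; apply/card_le1_eqP => u v.
  by move=> /setIdP[uI cu] /setIdP[vI cv]; apply: (D _ _ c).
Qed.

Lemma cells_unit c : cells s (c, false) = [set c]%SET.
Proof.
by apply/setP => -[d1 d2]; case: c => c1 c2; rewrite !inE /side /= xpair_eqE -!val_eqE /=; lia.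
Qed.

Lemma packing_sub {I J : {set cell n}} : I \subset J -> packing J -> packing I.
Proof.
move=> /fintype.subsetP IJ /packingP[F D]; apply/packingP; split=> [u /IJ /F //|].
by move=> u v c /IJ uJ /IJ vJ; apply: D.
Qed.

Lemma in_tiling_set I c b : ((c, b) \in tiling_set I) =
  if b then c \in I else [forall u in I, c \notin cells s (u, true)].
Proof. by rewrite finset.in_set; case: b. Qed.

Lemma in_block_units v c b :
  ((c, b) \in block_units s v) = ~~ b && (c \in cells s (v, true)).
Proof. by rewrite [LHS]finset.in_set. Qed.

Lemma bigs_tiling_set I : bigs (tiling_set I) = I.
Proof. by apply/setP => u; rewrite !inE. Qed.

Lemma is_tiling_tiling_set I : packing I -> is_tiling s (tiling_set I).
Proof.
move=> /packingP[F D]; apply/andP; split.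
  apply/forall_inP => -[u []]; rewrite inE /=; first exact: F.
  by move=> _; rewrite /fits /side /= !addn1; case: u => u1 u2 /=; rewrite !ltn_ord.
apply/forallP => c; apply/cards1P.
have [u /andP[uI cu]|nc] := pickP (fun u => (u \in I) && (c \in cells s (u, true))).
  exists (u, true); apply/setP => -[v []]; rewrite finset.in_set1 finset.in_set
    xpair_eqE ?andbT ?andbF.
    rewrite finset.in_set /=; apply/andP/eqP => [[vI cv]|-> //]; exact: (D _ _ c).
  rewrite cells_unit finset.in_set1 finset.in_set /=; apply/negP => /andP[/forall_inP H /eqP ec].
  by have := H _ uI; rewrite -ec cu.
exists (c, false); apply/setP => -[v []]; rewrite finset.in_set1 finset.in_set
    xpair_eqE ?andbT ?andbF.
  by rewrite finset.in_set /=; exact: nc.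
rewrite cells_unit finset.in_set1 finset.in_set /= [v == c]eq_sym; apply: andb_idl => /eqP <-.
by apply/forall_inP => u uI; have := nc u; rewrite /= uI => /negbT.
Qed.

(** The large squares determine the tiling: a cell that none of them covers can only be covered by
    the unit square placed at that cell. *)
Lemma tilingP {T} : is_tiling s T -> packing (bigs T) /\ T = tiling_set (bigs T).
Proof.
move=> /andP[/forall_inP F /forallP D].
have C c : exists2 q, q \in T & c \in cells s q.
  have /cards1P[q eq_q] := D c.
  by have := finset.set11 q; rewrite -eq_q => /setIdP[qT cq]; exists q.
have {}D p q c : p \in T -> q \in T -> c \in cells s p -> c \in cells s q -> p = q.
  move=> pT qT cp cq; have /cards1P[r er] := D c.
  have: p \in [set r]%SET by rewrite -er finset.in_set pT cp.
  have: q \in [set r]%SET by rewrite -er finset.in_set qT cq.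
  by rewrite !finset.in_set1 => /eqP -> /eqP ->.
have P : packing (bigs T).
  apply/packingP; split=> [u|u v c]; first by rewrite finset.in_set => /F.
  by rewrite finset.in_set [v \in _]finset.in_set => uT vT cu cv; have [] := D _ _ c uT vT cu cv.
split=> //; apply/setP => -[u []]; rewrite !finset.in_set //=; apply/idP/forall_inP => [uT v|H].
  rewrite finset.in_set => vT; apply/negP => uv.
  by have := D _ _ u vT uT uv; rewrite cells_unit finset.set11 => /(_ isT).
have [[v []] vT] := C u; first by rewrite (negbTE (H v _)) // finset.in_set.
by rewrite cells_unit => /set1P ->.
Qed.

(** The two ways to be flippable merge into one condition: if [v] is in [I] then [v |: I] is [I],
    and a block made of units is one that no square of [I] meets. *)
Lemma can_flip_tiling_set I v : packing I -> can_flip s (tiling_set I) v = packing (v |: I).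
Proof.
move=> PI; have [F D] := packingP _ PI.
apply/andP/idP => [[fv /orP[]]|P].
- by rewrite finset.in_set /= => vI; rewrite (finset.setUidPr _) ?finset.sub1set.
- move=> /fintype.subsetP B; apply/packingP.
  have N u c : u \in I -> c \in cells s (u, true) -> c \in cells s (v, true) -> False.
    move=> uI cu cv; have := B (c, false); rewrite in_block_units in_tiling_set cv.
    move=> /(_ isT) /forall_inP.
    by move=> /(_ _ uI); rewrite cu.
  split=> [u /setU1P[-> //|/F //]|u w c /setU1P[->|uI] /setU1P[->|wI] // cu cw].
  + by case: (N _ _ wI cw cu).
  + by case: (N _ _ uI cu cw).
  + exact: (D _ _ c).
- have [F' D'] := packingP _ P.
  split; first by apply: F'; rewrite finset.setU11.
  rewrite in_tiling_set; have [//|vI] := boolP (v \in I).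
  apply/fintype.subsetP => -[c b]; rewrite in_block_units in_tiling_set => /andP[/= /negbTE -> cv].
  apply/forall_inP => u uI; apply: contra vI => cu.
  by rewrite -(D' u v c) ?finset.in_setU1 ?uI ?eqxx ?orbT.
Qed.

Lemma put_units_tiling_set I v : packing (v |: I) ->
  put_units s (tiling_set I) v = tiling_set (I :\ v).
Proof.
move=> /packingP[F D].
apply/setP => -[c []];
  rewrite finset.in_setU finset.in_setD1 in_block_units !in_tiling_set xpair_eqE ?andbF ?andbT ?orbF /=.
  by rewrite finset.in_setD1.
apply/orP/forall_inP => [[/forall_inP H u /setD1P[_ uI]|cv u /setD1P[uv uI]]|H].
- exact: H.
- apply: contra uv => cu; apply/eqP; apply: (D u v c) => //; rewrite ?finset.in_setU1 ?eqxx ?uI ?orbT //.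
- have [cv|cv] := boolP (c \in cells s (v, true)); [by right|left].
  apply/forall_inP => u uI; have [->//|uv] := eqVneq u v.
  by apply: H; rewrite finset.in_setD1 uv.
Qed.

Lemma put_big_tiling_set I v :
  put_big s (tiling_set I) v = tiling_set (v |: I).
Proof.
apply/setP => -[c []];
  rewrite finset.in_setU1 finset.in_setD in_block_units !in_tiling_set xpair_eqE ?andbF ?andbT /=.
  by rewrite finset.in_setU1.
apply/andP/forall_inP => [[cv /forall_inP H u] /setU1P[->|uI]|H].
- by [].
- exact: H.
split; first by have := H v; rewrite finset.setU11; apply.
by apply/forall_inP => u uI; apply: H; rewrite finset.in_setU1 uI orbT.
Qed.

(** * Conflicting cells and their total weight *)

Definition close_coord (a b : nat) : bool := (a < b + s)%N && (b < a + s)%N.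

Definition overlap u v : bool := close_coord u.1 v.1 && close_coord u.2 v.2.

Lemma overlap_cells u v c :
  c \in cells s (u, true) -> c \in cells s (v, true) -> overlap u v.
Proof.
by rewrite !finset.in_set /overlap /close_coord /side /=; lia.
Qed.

Lemma packing_far I u v : packing (u |: I) -> packing (v |: I) ->
  ~~ overlap u v -> packing (u |: (v |: I)).
Proof.
move=> /packingP[Fu Du] /packingP[Fv Dv] uv.
have nuv c : c \in cells s (u, true) -> c \in cells s (v, true) -> False.
  by move=> cu cv; case/negP: uv; exact: overlap_cells cu cv.
have Iu w x : x \in I -> x \in w |: I by move=> xI; rewrite finset.in_setU1 xI orbT.
apply/packingP; split=> [x /setU1P[->|]|x y c].
- by apply: Fu; rewrite finset.setU11.
- by apply: Fv.
move=> /setU1P[->|/setU1P[->|xI]] /setU1P[->|/setU1P[->|yI]] // cx cy.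
- by case: (nuv c).
- by apply: (Du _ _ c) => //; rewrite ?finset.setU11 ?Iu.
- by case: (nuv c).
- by apply: (Dv _ _ c) => //; rewrite ?finset.setU11 ?Iu.
- by apply: (Du _ _ c) => //; rewrite ?finset.setU11 ?Iu.
- by apply: (Dv _ _ c) => //; rewrite ?finset.setU11 ?Iu.
- by apply: (Du _ _ c) => //; rewrite ?finset.setU11 ?Iu.
Qed.

(** Each index [i] close to [a] is [a + k - (s - 1)] for exactly one of the 2s-1 values of [k].
    Values of [k] that leave the region only add nonnegative terms; [h] lives on the reals because
    such a position may be negative. *)
Lemma sum_close_le (a : nat) (h : R -> R) : (0 < s)%N ->
  (forall k : 'I_(2 * s).-1, 0 <= h (a%:R + k%:R - s.-1%:R)) ->
  \sum_(i < n | close_coord i a) h i%:R <=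
    \sum_(k < (2 * s).-1) h (a%:R + k%:R - s.-1%:R).
Proof.
move=> s_gt0 h0.
have -> : \sum_(i < n | close_coord i a) h i%:R =
    \sum_(i < n) \sum_(k < (2 * s).-1 | (a + k == i + s.-1)%N) h (a%:R + k%:R - s.-1%:R).
  rewrite [LHS]big_mkcond; apply: eq_bigr => i _; case: ifPn => ci.
    have ki : (i + s.-1 - a < (2 * s).-1)%N by move: ci; rewrite /close_coord; lia.
    rewrite (big_pred1 (Ordinal ki)) /=.
      by congr (h _); rewrite -natrD (_ : (a + _ = i + s.-1)%N) ?natrD ?addrK //;
        move: ci; rewrite /close_coord; lia.
    by move=> k; rewrite /= -(inj_eq val_inj) /=; move: ci; rewrite /close_coord; lia.
  rewrite big_pred0 // => k; have := ltn_ord k; move: ci; rewrite /close_coord; lia.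
rewrite (exchange_big_dep predT) //=; apply: ler_sum => k _.
have [i /eqP ei|ni] := pickP (fun i : 'I_n => a + k == i + s.-1)%N.
  rewrite (big_pred1 i) // => j; rewrite /= -(inj_eq val_inj) /=; lia.
by rewrite big_pred0.
Qed.

Definition weight v : R := 2 * n%:R ^+ 2 - v.1%:R ^+ 2.

Lemma weight_ge v : n%:R ^+ 2 <= weight v.
Proof.
have : (v.1%:R : R) <= n%:R by rewrite ler_nat ltnW.
rewrite /weight; have : (0 : R) <= v.1%:R by []. nra.
Qed.

Lemma weight_le v : weight v <= 2 * n%:R ^+ 2.
Proof. by rewrite /weight; have := sqr_ge0 (v.1%:R : R); lra. Qed.

(** The reflection k -> 2s-2-k negates every offset. This cancels the linear term when the weight is
    expanded around [v]. *)
Lemma sum_offset : (0 < s)%N -> \sum_(k < (2 * s).-1) (k%:R - s.-1%:R) = 0 :> R.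
Proof.
move=> s_gt0; suff E : \sum_(k < (2 * s).-1) (k%:R - s.-1%:R) =
    - \sum_(k < (2 * s).-1) (k%:R - s.-1%:R) :> R by lra.
rewrite [LHS](reindex_inj rev_ord_inj) -sumrN /=; apply: eq_bigr => k _.
have k_lt := ltn_ord k; rewrite natrB //.
rewrite [X in X%:R - _ - _](_ : (2 * s).-1 = s.-1 + s.-1 + 1)%N; last by lia.
by rewrite -[k.+1]addn1 !natrD; ring.
Qed.

Lemma sum_offset_sqr : (0 < s)%N ->
  (2 * s.-1)%:R <= \sum_(k < (2 * s).-1) (k%:R - s.-1%:R) ^+ 2 :> R.
Proof.
move=> s_gt0; have k0 : (s.-1 < (2 * s).-1)%N by lia.
(* Only the middle offset vanishes; the other 2(s-1) are nonzero integers, with squares at least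
   1. *)
rewrite (bigD1 (Ordinal k0)) //= subrr expr0n add0r.
have -> : (2 * s.-1)%:R = \sum_(k < (2 * s).-1 | k != Ordinal k0) 1 :> R.
  rewrite sumr_const; congr (_%:R); have := cardC1 (Ordinal k0); rewrite card_ord.
  rewrite (_ : (2 * s).-1.-1 = 2 * s.-1)%N; last by lia.
  by move=> <-; apply: eq_card.
apply: ler_sum => k; rewrite -(inj_eq val_inj) /= => ks.
have : k%:R + 1 <= s.-1%:R :> R \/ s.-1%:R + 1 <= k%:R :> R.
  by rewrite !natr1 !ler_nat; lia.
by case=> ?; nra.
Qed.

(** With m = 2s-1, the sum including [v] is at most m(m w(v) - D), where D is the sum of squared
    offsets. Removing [v] leaves (m^2-1) w(v) - m D, where m^2-1 = 4s(s-1) and m D >= 2s(s-1), from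
    D >= 2(s-1) and m >= s. *)
Lemma sum_overlap_weight v : (2 <= s)%N -> fits s (v, true) ->
  \sum_(u | (u != v) && overlap u v) weight u <=
    4 * s%:R * (s%:R - 1) * (weight v - 2^-1).
Proof.
move=> s_ge2; have s_gt0 := ltnW s_ge2; move=> /andP[/= v1 _]; have {}v1 : (v.1 + s <= n)%N by [].
set D : R := \sum_(k < (2 * s).-1) (k%:R - s.-1%:R) ^+ 2.
pose m : R := 2 * s%:R - 1.
have m_eq : (2 * s).-1%:R = m by rewrite /m -subn1 natrB ?natrM //; lia.
have s1_eq : s.-1%:R = s%:R - 1 :> R by rewrite -subn1 natrB //; lia.
have s2 : 2 <= s%:R :> R by rewrite ler_nat.
have nvv : overlap v v by rewrite /overlap /close_coord; lia.
have W : \sum_(u | overlap u v) weight u <= m * (m * weight v - D).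
  rewrite /overlap -(pair_big (fun i : 'I_n => close_coord i v.1) (fun j : 'I_n => close_coord j v.2)
     (fun i j => 2 * n%:R ^+ 2 - i%:R ^+ 2)) /=.
  apply: (@le_trans _ _ (\sum_(i < n | close_coord i v.1) m * (2 * n%:R ^+ 2 - i%:R ^+ 2))).
    apply: ler_sum => i _; rewrite sumr_const -[leLHS]mulr_natl.
    have := @sum_close_le v.2 (fun=> 1) s_gt0 (fun=> ler01); rewrite !sumr_const card_ord m_eq.
    move=> cm; apply: ler_wpM2r cm.
    by apply: le_trans (weight_ge (i, v.2)); rewrite sqr_ge0.
  rewrite -mulr_sumr; apply: ler_wpM2l; first by rewrite /m; lra.
  (* Since the square at [v] fits, every shifted first coordinate x satisfies |x| <= n, so the
     extended weight 2n^2 - x^2 stays nonnegative even outside the region. *)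
  apply: (le_trans (@sum_close_le v.1 (fun x => 2 * n%:R ^+ 2 - x ^+ 2) s_gt0 _)) => [k|].
    have : (v.1%:R + k%:R + 1 <= n%:R + s.-1%:R :> R).
      by rewrite -!natrD natr1 ler_nat; have := ltn_ord k; move: v1; lia.
    have : s.-1%:R + 1 <= n%:R :> R by rewrite natr1 ler_nat; lia.
    have : 0 <= v.1%:R + k%:R :> R by rewrite -natrD.
    move=> x0 s1n xs; rewrite subr_ge0.
    set x := _ - _; have : x <= n%:R by rewrite /x; lra.
    have : - n%:R <= x by rewrite /x; lra.
    by move=> *; nra.
  rewrite (eq_bigr (fun k : 'I__ => weight v - 2 * v.1%:R * (k%:R - s.-1%:R)
     - (k%:R - s.-1%:R) ^+ 2)); last by move=> k _; rewrite /weight; ring.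
  rewrite 2!sumrB -[X in _ - X - _]mulr_sumr sum_offset // mulr0 subr0 sumr_const card_ord.
  by rewrite -[weight v *+ _]mulr_natl m_eq lexx.
rewrite (bigD1 v) //= in W.
have DD : 2 * (s%:R - 1) <= D by rewrite -s1_eq -natrM; exact: sum_offset_sqr.
have -> : \sum_(u | (u != v) && overlap u v) weight u = \sum_(u | overlap u v && (u != v)) weight u.
  by apply: eq_bigl => u; rewrite andbC.
have : m * (2 * (s%:R - 1)) <= m * D by apply: ler_wpM2l; [rewrite /m; lra|exact: DD].
move: W; rewrite /m; nra.
Qed.

(** * Heat-bath dynamics on packings and its contraction *)

Definition flip_mean lam G I v : R :=
  if packing (v |: I)
  then (lam + 1)^-1 * G (I :\ v) + lam / (lam + 1) * G (v |: I)
  else G I.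

Definition glauber lam G I : R := \sum_v #|cell n|%:R^-1 * flip_mean lam G I v.

Definition flip_lipschitz (L : R) G : Prop := forall I v, v \notin I ->
  packing (v |: I) -> `|G (v |: I) - G I| <= L * weight v.

(** With D = 4s(s-1) the threshold is 1/(D-1), and lam <= 1/(D-1) amounts to lam/(lam+1) <= 1/D. *)
Lemma flip_prob_le lam : (2 <= s)%N -> 0 < lam -> lam <= 1 / ((2 * s%:R - 1) ^+ 2 - 2) ->
  lam / (lam + 1) * (4 * s%:R * (s%:R - 1)) <= 1.
Proof.
move=> s_ge2 lam_gt0 lam_le.
have s2 : 2 <= s%:R :> R by rewrite ler_nat.
have D0 : 0 < (2 * s%:R - 1) ^+ 2 - 2 :> R.
  rewrite subr_gt0; have : 3 <= 2 * s%:R - 1 :> R by lra.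
  by set x := 2 * _ - 1 => x3; nra.
move: lam_le; rewrite ler_pdivlMr // => H {D0}.
rewrite mulrAC ler_pdivrMr ?addr_gt0 //.
lra.
Qed.

Lemma norm_convex_le (p M x y : R) : 0 <= p <= 1 -> `|x| <= M -> `|y| <= M ->
  `|(1 - p) * x + p * y| <= M.
Proof.
move=> /andP[p0 p1] xM yM; have q0 : 0 <= 1 - p by rewrite subr_ge0.
apply: (le_trans (ler_normD _ _)); rewrite !normrM (ger0_norm p0) (ger0_norm q0).
rewrite [leRHS](_ : M = (1 - p) * M + p * M); last by ring.
by apply: lerD; apply: ler_wpM2l.
Qed.

Lemma setD1_notin I v : v \notin I -> I :\ v = I.
Proof. by move=> vI; apply/finset.setDidPl; rewrite disjoint_sym finset.disjoints1. Qed.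

(** An update at the site of disagreement makes the two copies coalesce. *)
Lemma flip_mean_self lam G I v : v \notin I -> packing (v |: I) ->
  flip_mean lam G (v |: I) v = flip_mean lam G I v.
Proof.
move=> vI P; rewrite /flip_mean finset.setUA finset.setUid P.
by rewrite finset.setU1K // setD1_notin.
Qed.

(** If [u] can be flipped in both packings, the difference is a convex combination of two
    differences across [v]; if in neither, it is unchanged. If only in [I], then [u] conflicts with
    [v], and adding [u] to one copy costs an extra [L * weight u] with probability
    [lam / (lam + 1)]. *)
Lemma flip_mean_lipschitz lam (L : R) G I u v : 0 < lam -> flip_lipschitz L G -> 0 <= L ->
  v \notin I -> packing (v |: I) -> u != v ->
  `|flip_mean lam G (v |: I) u - flip_mean lam G I u| <=
    L * weight v + (if overlap u v then L * (lam / (lam + 1) * weight u) else 0).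
Proof.
move=> lam_gt0 GL L0 vI Pv uv.
have p0 : 0 <= lam / (lam + 1) by apply: divr_ge0; lra.
have q0 : 0 <= (lam + 1)^-1 by rewrite invr_ge0; lra.
have pq : (lam + 1)^-1 = 1 - lam / (lam + 1) by field; lra.
move: q0 pq; set p := lam / (lam + 1) in p0 *; set q := (lam + 1)^-1 => q0 pq.
have e0 : 0 <= (if overlap u v then L * (lam / (lam + 1) * weight u) else 0).
  by case: ifP => // _; do 2!apply: mulr_ge0 => //; apply: le_trans (weight_ge u); exact: sqr_ge0.
have PI : packing I by apply: packing_sub Pv; rewrite finset.subsetUr.
have GLv := GL _ _ vI Pv.
rewrite /flip_mean; rewrite -/p -/q.
rewrite pq in q0 *.
case: ifPn => [PuJ|nPuJ].
  have uvI : u |: (v |: I) = v |: (u |: I) by rewrite finset.setUCA.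
  have PuI : packing (u |: I).
    by apply: packing_sub PuJ; rewrite uvI finset.subsetUr.
  have vuI : v \notin u |: I by rewrite finset.in_setU1 negb_or eq_sym uv.
  have JDu : (v |: I) :\ u = v |: (I :\ u).
    by apply/setP => x; rewrite !finset.inE; have [->|] := eqVneq x v; rewrite ?andbT // eq_sym.
  have vDu : v \notin I :\ u by rewrite finset.in_setD1 negb_and vI orbT.
  have H1 := GL _ _ vuI; rewrite -uvI in H1; have {}H1 := H1 PuJ.
  have H2 : `|G ((v |: I) :\ u) - G (I :\ u)| <= L * weight v.
    rewrite JDu; apply: GL => //; rewrite -JDu; apply: packing_sub Pv; exact: finset.subD1set.
  rewrite PuI.
  rewrite [X in `|X|](_ : _ = (1 - p) * (G ((v |: I) :\ u) - G (I :\ u)) +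
    p * (G (u |: (v |: I)) - G (u |: I))); last by ring.
  have p01 : 0 <= p <= 1 by rewrite p0 -subr_ge0.
  by apply: (le_trans (norm_convex_le _ _ _ _ p01 H2 H1)); rewrite lerDl.
case: ifPn => [PuI|_]; last by apply: le_trans GLv _; rewrite lerDl.
(* [u] fits together with [I] but not with [v |: I], so the obstruction is [v] itself. *)
have nuv : overlap u v.
  by apply: (contraR _ nPuJ) => nn; exact: packing_far.
have uI : u \notin I.
  by apply: (contra _ nPuJ) => uI; rewrite (finset.setUidPr _) // finset.sub1set finset.in_setU1 uI orbT.
rewrite nuv setD1_notin //.
have GLu := GL _ _ uI PuI.
 rewrite [X in `|X|](_ : _ = G (v |: I) - G I - p * (G (u |: I) - G I)); last by ring.
apply: (le_trans (ler_normB _ _)); apply: lerD => //.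
by rewrite normrM ger0_norm // mulrCA; apply: ler_wpM2l.
Qed.

(** Let N = n^2 be the number of sites. The site [v] contributes 0, the other N-1 sites contribute
    w(v) each, and the conflicting ones at most w(v) - 1/2 more in total. The sum N w(v) - 1/2 is at
    most N w(v)(1 - 1/(4n^4)) because w(v) <= 2n^2. *)
Lemma glauber_contraction lam (L : R) G :
  (0 < n)%N -> (2 <= s)%N -> 0 < lam -> lam <= 1 / ((2 * s%:R - 1) ^+ 2 - 2) ->
  0 <= L -> flip_lipschitz L G ->
  flip_lipschitz (L * (1 - (4 * n%:R ^+ 4)^-1)) (glauber lam G).
Proof.
move=> n_gt0 s_ge2 lam_gt0 lam_le L0 GL I v vI Pv.
have n1 : 1 <= n%:R :> R by rewrite ler1n.
have N0 : 0 < (#|cell n|%:R : R) by rewrite card_prod card_ord ltr0n muln_gt0 n_gt0.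
have N_eq : #|cell n|%:R = n%:R ^+ 2 :> R by rewrite card_prod card_ord natrM.
have fv : fits s (v, true) by have [F _] := packingP _ Pv; apply: F; rewrite finset.setU11.
rewrite /glauber -!mulr_sumr -mulrBr normrM gtr0_norm ?invr_gt0 //.
rewrite ler_pdivrMl // -sumrB.
have p0 : 0 <= lam / (lam + 1) by apply: divr_ge0; lra.
have B : \sum_u `|flip_mean lam G (v |: I) u - flip_mean lam G I u| <=
   L * ((#|cell n|%:R - 1) * weight v + lam / (lam + 1) *
        \sum_(u | (u != v) && overlap u v) weight u).
  rewrite (bigD1 v) //= flip_mean_self // subrr normr0 add0r.
  apply: (le_trans (ler_sum _ (fun u uv => flip_mean_lipschitz _ _ _ _ _ _ lam_gt0 GL L0 vI Pv uv))).
  rewrite big_split /= sumr_const -big_mkcondr /= -!mulr_sumr [leRHS]mulrDr.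
  rewrite (_ : #|_| = #|cell n|.-1); last first.
    by have := cardC1 v; move=> <-; apply: eq_card.
  have N1 : #|cell n|.-1%:R = #|cell n|%:R - 1 :> R.
    by rewrite -subn1 natrB // -(ltr_nat R).
  by rewrite -[_ *+ _]mulr_natr N1 lerD2r -mulrA ler_wpM2l // mulrC lexx.
apply: (le_trans (ler_norm_sum _ _ _)); apply: (le_trans B).
rewrite [leRHS](_ : _ = L * (#|cell n|%:R * ((1 - (4 * n%:R ^+ 4)^-1) * weight v))).
  2: by rewrite -mulrA mulrCA.
apply: ler_wpM2l => //.
have w1 := weight_ge v; have w2 := weight_le v.
have S := sum_overlap_weight v s_ge2 fv.
have pS : lam / (lam + 1) * \sum_(u | (u != v) && overlap u v) weight u <= weight v - 2^-1.
  apply: (le_trans (ler_wpM2l p0 S)); rewrite mulrA.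
  apply: ler_piMl; last exact: flip_prob_le.
  by have : 1 <= n%:R ^+ 2 :> R; [rewrite exprn_ege1|lra].
have cw : n%:R ^+ 2 * (4 * n%:R ^+ 4)^-1 * weight v <= 2^-1 :> R.
  apply: (@le_trans _ _ (n%:R ^+ 2 * (4 * n%:R ^+ 4)^-1 * (2 * n%:R ^+ 2))).
    by apply: ler_wpM2l => //; rewrite divr_ge0 ?mulr_ge0 ?exprn_ge0.
  by rewrite (_ : _ * _ = 2^-1) //; field; lra.
rewrite N_eq; lra.
Qed.

(** * Transfer to the tiling chain and decay of total variation *)

Lemma sum_tiling_set f G J : (forall x, f x = G (bigs (val x))) -> packing J ->
  \sum_y (val y == tiling_set J)%:R * f y = G J.
Proof.
move=> fG PJ; have TJ := is_tiling_tiling_set _ PJ.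
pose y0 : tiling s n := exist (fun T => is_tiling s T) _ TJ; have y0E : val y0 = tiling_set J by [].
rewrite (bigD1 y0) //= eqxx mul1r fG y0E bigs_tiling_set.
rewrite big1 ?addr0 // => y; rewrite -(inj_eq val_inj) y0E => /negbTE ->.
by rewrite mul0r.
Qed.

Lemma MC_square_glauber (lam : R) f G x : (forall y, f y = G (bigs (val y))) ->
  \sum_y MC_square lam x y * f y = glauber lam G (bigs (val x)).
Proof.
move=> fG; have [PI xE] := tilingP (valP x); set I := bigs (val x) in PI xE *.
rewrite /MC_square; under eq_bigr do rewrite mulr_suml.
rewrite exchange_big /=; apply: eq_bigr => v _.
have scale (a : R) (c : tiling s n -> R) : \sum_y a * c y * f y = a * \sum_y c y * f y.
  by rewrite mulr_sumr; apply: eq_bigr => y _; rewrite mulrA.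
rewrite scale; congr (_ * _).
rewrite /flip_mean -[sval x]/(val x) xE can_flip_tiling_set //; case: ifPn => PvI.
  rewrite put_units_tiling_set // put_big_tiling_set.
  under eq_bigr do rewrite mulrDl.
  rewrite big_split /= !scale.
  rewrite !(sum_tiling_set _ G) //; last exact: packing_sub (finset.subD1set _ _) PI.
rewrite (bigD1 x) //= eqxx mul1r big1 ?addr0 // => y /negbTE ->.
by rewrite mul0r.
Qed.

(** Remove the squares one at a time: every intermediate set is still a packing, and each removal
    costs at most [L] times the maximal weight. *)
Lemma lipschitz_card (L : R) G I : 0 <= L -> flip_lipschitz L G ->
  packing I ->
  `|G I - G finset.set0| <= #|I|%:R * (L * (2 * n%:R ^+ 2)).
Proof.
move=> L0 GL; move: {2}#|I| (erefl #|I|) => k; elim: k I => [|k IH] I.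
  by move/eqP; rewrite cards_eq0 => /eqP -> _; rewrite subrr normr0 cards0 mul0r.
move=> cI PI; have /card_gt0P[v vI] : (0 < #|I|)%N by rewrite cI.
have cD : #|I :\ v| = k by move: cI; rewrite (cardsD1 v) vI => -[].
have vD : v \notin I :\ v by rewrite finset.setD11.
have H1 := GL _ _ vD; rewrite (finset.setD1K vI) in H1.
have H2 := IH _ cD (packing_sub (finset.subD1set _ _) PI).
have -> : G I - G finset.set0 = (G I - G (I :\ v)) + (G (I :\ v) - G finset.set0).
  by rewrite addrA subrK.
apply: (le_trans (ler_normD _ _)).
have H3 : L * weight v <= L * (2 * n%:R ^+ 2) by apply: ler_wpM2l => //; exact: weight_le.
have {}H1 := H1 PI; rewrite cI -natr1 -cD; lra.
Qed.

Lemma iter_lipschitz (lam : R) f t : (0 < n)%N -> (2 <= s)%N -> 0 < lam ->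
  lam <= 1 / ((2 * s%:R - 1) ^+ 2 - 2) -> (forall y, `|f y| <= 1) -> tiling s n ->
  exists2 G, flip_lipschitz (2 / n%:R ^+ 2 * (1 - (4 * n%:R ^+ 4)^-1) ^+ t) G &
    forall x, \sum_y iter_trans (MC_square lam (n := n)) t x y * f y = G (bigs (val x)).
Proof.
move=> n0 s2 lam0 lamle f1 x0.
have n1 : 1 <= n%:R :> R by rewrite ler1n.
have n2 : 1 <= n%:R ^+ 2 :> R by rewrite exprn_ege1.
have d0 : 0 <= 1 - (4 * n%:R ^+ 4)^-1 :> R.
  rewrite subr_ge0 invf_le1; first by have := exprn_ege1 4 n1; lra.
  by have := exprn_ege1 4 n1; lra.
elim: t => [|t [G GL GE]].
  (* [insubd] extends [f] to all sets, with default tiling [x0] where [tiling_set I] is not a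
     tiling. As |f| <= 1, differences are at most 2, and w >= n^2 gives the initial constant
     2/n^2. *)
  exists (fun I => f (insubd x0 (tiling_set I))) => [I v vI PvI|x].
    apply: (@le_trans _ _ 2).
      by apply: (le_trans (ler_normB _ _)); have := f1 (insubd x0 (tiling_set I));
         have := f1 (insubd x0 (tiling_set (v |: I))); lra.
    rewrite expr0 mulr1 mulrAC ler_pdivlMr; last by lra.
    by apply: ler_wpM2l => //; exact: weight_ge.
  rewrite (bigD1 x) //= eqxx mul1r big1 ?addr0.
    by have [_ <-] := tilingP (valP x); rewrite valKd.
  by move=> y; rewrite eq_sym => /negbTE ->; rewrite mul0r.
exists (glauber lam G).
  rewrite [_ ^+ t.+1]exprSr mulrA; apply: glauber_contraction => //.
  by rewrite mulr_ge0 ?divr_ge0 ?exprn_ge0.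
move=> x /=; rewrite -(MC_square_glauber _ _ _ _ GE).
under eq_bigr do rewrite mulr_suml; rewrite exchange_big /=.
by apply: eq_bigr => z _; rewrite mulr_sumr; apply: eq_bigr => y _; rewrite mulrA.
Qed.

(** Any packing is reached from the empty one by at most n^2 additions, each changing [G] by at most
    2n^2 L with L = (2/n^2)(1 - 1/(4n^4))^t. Comparing two tilings through the empty packing doubles
    the bound, which the factor 2 in [tv_dist_le] absorbs. For n = 1 no large square fits, so there
    is nothing to mix. *)
Lemma tv_dist_MC_square (lam : R) (pi : tiling s n -> R) x t :
  (0 < n)%N -> (2 <= s)%N -> 0 < lam ->
  lam <= 1 / ((2 * s%:R - 1) ^+ 2 - 2) -> stationary (MC_square lam (n := n)) pi ->
  tv_dist (MC_square lam (n := n)) pi x t <=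
    if n == 1%N then 0 else 4 * n%:R ^+ 2 * (1 - (4 * n%:R ^+ 4)^-1) ^+ t.
Proof.
move=> n0 s2 lam0 lamle st; apply: tv_dist_le => // f f1 z.
have [G GL GE] := iter_lipschitz lam f t n0 s2 lam0 lamle f1 x.
have n1 : 1 <= n%:R :> R by rewrite ler1n.
have d0 : 0 <= 1 - (4 * n%:R ^+ 4)^-1 :> R.
  rewrite subr_ge0 invf_le1; first by have := exprn_ege1 4 n1; lra.
  by have := exprn_ege1 4 n1; lra.
set L := _ / _ * _ in GL.
have L0 : 0 <= L by rewrite mulr_ge0 ?divr_ge0 ?exprn_ge0.
have H (y : tiling s n) : `|G (bigs (val y)) - G finset.set0| <=
    if n == 1%N then 0 else n%:R ^+ 2 * (L * (2 * n%:R ^+ 2)).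
  have [PI _] := tilingP (valP y); have B := lipschitz_card _ _ _ L0 GL PI.
  case: ifPn => [/eqP e1|_].
    suff e0 : bigs (val y) = finset.set0 by move: B; rewrite e0 cards0 mul0r.
    apply/setP => v; rewrite finset.in_set0; apply/negP => vI.
    have [F _] := packingP _ PI; have := F _ vI; rewrite /fits /side /=; lia.
  apply: (le_trans B); apply: ler_wpM2r; first by rewrite !mulr_ge0 ?exprn_ge0.
  by rewrite -natrX ler_nat (leq_trans (max_card _)) // card_prod card_ord.
rewrite !GE.
have -> : G (bigs (val x)) - G (bigs (val z)) =
  (G (bigs (val x)) - G finset.set0) - (G (bigs (val z)) - G finset.set0) by ring.
apply: (le_trans (ler_normB _ _)).
have := H x; have := H z; case: ifP => _; first by lra.
have -> : n%:R ^+ 2 * (L * (2 * n%:R ^+ 2)) =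
   4 * n%:R ^+ 2 * (1 - (4 * n%:R ^+ 4)^-1) ^+ t.
  by rewrite /L; set r := _ ^+ t; field; lra.
lra.
Qed.

End Packings.

(** * From geometric decay to the mixing time *)

Lemma exp_decay_le {R : realType} (d A eps : R) t : 0 < d <= 1 -> 0 < eps -> 0 < A ->
  ln (A / eps) / d <= t%:R -> A * (1 - d) ^+ t <= eps.
Proof.
move=> /andP[d0 d1] e0 A0; rewrite ler_pdivrMr // => le_t.
rewrite mulrC -ler_pdivlMr //.
(* Uses 1 - d <= exp(-d). *)
apply: (@le_trans _ _ (expR (- d) ^+ t)).
  by rewrite lerXn2r ?nnegrE ?subr_ge0 ?expR_ge0 // -[1 - d]/(1 + - d) expR_ge1Dx.
rewrite -expRM_natl -[eps / A]lnK ?posrE ?divr_gt0 // ler_expR.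
rewrite -[eps / A]invf_div lnV ?posrE ?divr_gt0 // mulrN lerN2 //.
Qed.

Lemma tau_mix_MC_square (R : realType) (s : nat) (lam : R) n (eps : R) (pi : tiling s n -> R) :
  (2 <= s)%N -> 0 < lam -> lam <= 1 / ((2 * s%:R - 1) ^+ 2 - 2) ->
  (1 <= n)%N -> 0 < eps < 1 -> stationary (@MC_square R s lam n) pi ->
  (tau_mix (@MC_square R s lam n) pi eps
     <= (18 * n%:R ^+ 4 * ln (n%:R * eps^-1))%:E)%E.
Proof.
move=> s2 lam0 lamle n_gt0 /andP[e0 e1] st.
have ie1 : 1 < eps^-1 by rewrite invf_gt1.
have tvB := fun x t => tv_dist_MC_square lam pi x t n_gt0 s2 lam0 lamle st.
(* For n = 1 the logarithm tends to 0 as [eps] tends to 1 and could not absorb additive constants;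
   there the distance is already 0 at time 0. *)
have [n1|n1] := eqVneq n 1%N.
  apply: (@le_trans _ _ (0%:R)%:E).
    by apply: tau_mix_le => x t' _; apply: (le_trans (tvB x t')); rewrite n1 /= ltW.
  by rewrite lee_fin n1 mulr_ge0 ?mulr_ge0 ?exprn_ge0 // ln_ge0 // mul1r ltW.
have n2 : 2 <= n%:R :> R by rewrite ler_nat; lia.
set l := ln _; set N := n%:R ^+ 4.
have N1 : 1 <= N by rewrite /N exprn_ege1 //; lra.
have q0 : 0 < n%:R / eps by rewrite divr_gt0 //; lra.
have l2 : 2^-1 <= l.
  have : 1 + - l <= expR (- l) by exact: expR_ge1Dx.
  have -> : expR (- l) = eps / n%:R by rewrite expRN lnK ?posrE // invf_div.
  have : eps / n%:R <= 2^-1 by rewrite ler_pdivrMr; lra.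
  lra.
(* For n >= 2, 4n^2 <= n^4 and 1/eps <= 1/eps^4, so the argument is at most (n/eps)^4. *)
have lA : ln (4 * n%:R ^+ 2 / eps) <= 4 * l.
  rewrite [4 * l]mulr_natl /l -lnXn // ler_ln ?posrE ?exprn_gt0 //; last first.
    by rewrite divr_gt0 // mulr_gt0 // exprn_gt0 //; lra.
  rewrite exprMn; apply: ler_pM.
  - by rewrite mulr_ge0 ?exprn_ge0.
  - by rewrite invr_ge0 ltW.
  - by rewrite (exprD _ 2 2) ler_wpM2r ?exprn_ge0 //; nra.
  - by apply: ler_eXnr => //; exact: ltW.
set y := ln (4 * n%:R ^+ 2 / eps) / (4 * N)^-1.
have yle : y <= 16 * N * l by rewrite /y invrK; nra.
have y0 : 0 <= y.
  rewrite /y divr_ge0 ?invr_ge0 ?mulr_ge0 ?exprn_ge0 //.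
  by rewrite ln_ge0 // ler_pdivlMr //; nra.
(* Rounding up costs at most 1, and 1 <= 2 N l since l >= 1/2 and N >= 1. Added to 16 N l this gives
   the constant 18. *)
pose t := (Num.truncn y).+1.
have /andP[ty yt] := truncn_itv y0.
apply: (@le_trans _ _ (t%:R)%:E); last first.
  by rewrite lee_fin /t -natr1; nra.
apply: tau_mix_le => x t' tt'; apply: (le_trans (tvB x t')).
rewrite (negbTE n1); apply: exp_decay_le => //.
- by rewrite -/N invr_gt0 invf_le1; [apply/andP; split|]; lra.
- by rewrite mulr_gt0 // exprn_gt0 //; lra.
- by apply: (le_trans (ltW yt)); rewrite ler_nat.
Qed.

Theorem theorem6 (R : realType) (s : nat) (lam : R)
    (hs : (2 <= s)%N) (hlam : 0 < lam)
    (hle : lam <= 1 / ((2 * s%:R - 1) ^+ 2 - 2)) :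
  rapidly_mixing (@MC_square R s lam) /\
  exists c : R, 0 < c /\
    forall (n : nat) (eps : R) (pi : tiling s n -> R),
      (1 <= n)%N -> 0 < eps < 1 ->
      stationary (@MC_square R s lam n) pi ->
      (tau_mix (@MC_square R s lam n) pi eps
         <= (c * n%:R ^+ 4 * ln (n%:R * eps^-1))%:E)%E.
Proof.
split; last first.
  by exists 18; split=> // n eps pi n1 e01 st; exact: tau_mix_MC_square.
(* The outer variable stands for n and the inner one for ln(1/eps). Splitting ln(n/eps) and bounding
   ln n by n makes the estimate polynomial. *)
exists (18%:P%:P * 'X^4 * ('X + 'X%:P)) => n eps pi n1 /andP[e0 e1] st.
apply: (le_trans (tau_mix_MC_square _ _ _ _ _ _ hs hlam hle n1 _ st)); first by rewrite e0.
rewrite lee_fin !hornerE /=.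
rewrite lnM ?posrE ?invr_gt0 ?ltr0n //.
apply: ler_wpM2l; first by rewrite mulr_ge0 ?exprn_ge0.
by rewrite lerD2r; apply/ltW/ln_sublinear; rewrite ltr0n.
Qed.
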